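(* Let $(C,\phi)$ be an $n$-component semicoherent system with continuous and i.i.d. component lifetimes, with signature $(s_1,\ldots,s_n)$ and tail signature $(\overline{S}_0,\ldots,\overline{S}_n)$, and let $h(x)$ be the diagonal section of its reliability function and $h'(x)$ the derivative of $h(x)$. Then, as polynomial identities in $x$, $$\sum_{k=0}^n \overline{S}_k\, x^k = \int_0^1 (n+1)\, R^n_t\, \big((R^{n}h)((t-1)\, x+1)\big)\, dt,$$ $$\sum_{k=1}^n s_k\, x^k = \int_0^1 x\, R^{n-1}_t\, \big((R^{n-1}h')((t-1)\, x+1)\big)\, dt,$$ where $R_t^m$ is the $m$-reflection with respect to the variable $t$.
   Context: $n\ge 1$, $C=[n]=\{1,\ldots,n\}$ is the set of components, and $\phi\colon\{0,1\}^n\to\{0,1\}$ is the structure function. The system is semicoherent: $\phi$ is nondecreasing in each variable, $\phi(0,\ldots,0)=0$ and $\phi(1,\ldots,1)=1$. Boolean vectors $\mathbf{x}\in\{0,1\}^n$ are identified with subsets $A\subseteq C$ by $x_i=1$ iff $i\in A$, so one writes $\phi(A)$. The components have continuous i.i.d. lifetimes $T_1,\ldots,T_n$; $T_{k:n}$ is the $k$-th smallest lifetime and $T_S$ is the system lifetime, i.e. the time at which the system fails, $T_S=\max_{A:\phi(A)=1}\min_{i\in A}T_i$. The signature is $\mathbf{s}=(s_1,\ldots,s_n)$ with $s_k=\Pr(T_S=T_{k:n})$, and the tail signature is $(\overline{S}_0,\ldots,\overline{S}_n)$ with $\overline{S}_k=\sum_{i=k+1}^n s_i$. The reliability function is the multilinear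 polynomial function $h(x_1,\ldots,x_n)=\sum_{A\subseteq C}\phi(A)\prod_{i\in A}x_i\prod_{i\in C\setminus A}(1-x_i)$ on $[0,1]^n$; its diagonal section is the univariate polynomial $h(x)=h(x,\ldots,x)$, of degree at most $n$, regarded as a real polynomial. For a univariate polynomial $f(x)=a_mx^m+\cdots+a_1x+a_0$ of degree at most $m$, the $m$-reflected polynomial $R^mf$ is $(R^mf)(x)=a_0x^m+a_1x^{m-1}+\cdots+a_{m-1}x+a_m$, i.e. $(R^mf)(x)=x^mf(1/x)$. For a polynomial $F(t,x)$ of degree at most $m$ in $t$, $R^m_tF$ is the $m$-reflected polynomial of $F$ regarded as a polynomial in $t$, i.e. $(R^m_tF)(t,x)=t^mF(1/t,x)$. The notation $(R^{n}h)((t-1)x+1)$ means $R^nh$ evaluated at $(t-1)x+1$. *)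

(* Defs.v *)
From HB Require Import structures.
From mathcomp Require Export all_boot all_order all_algebra.
From mathcomp Require Export polyXY.
From mathcomp Require Export all_classical all_reals all_analysis.
Export Order.TTheory GRing.Theory Num.Theory.
Export numFieldNormedType.Exports.

Set Implicit Arguments.
Unset Strict Implicit.
Unset Printing Implicit Defensive.

Local Open Scope classical_set_scope.
Local Open Scope ring_scope.

(* Components are indexed by 'I_n = {0, ..., n-1} instead of {1, ..., n}, and a
   Boolean vector x is the set {set 'I_n} of the i such that x_i = 1. *)

Definition semicoherent (n : nat) (phi : {set 'I_n} -> bool) : Prop :=
  [/\ forall (A : {set 'I_n}) (i : 'I_n), phi A -> phi (i |: A)%SET,
      phi finset.set0 = false
    & phi [set: 'I_n]%SET = true].

(* The multilinear formula makes sense over any commutative ring: evaluated at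
   x_i = 'X in {poly R}, it yields the diagonal section as a polynomial. *)
Definition reliability (K : comNzRingType) (n : nat) (phi : {set 'I_n} -> bool)
    (x : 'I_n -> K) : K :=
  \sum_(A : {set 'I_n})
    (phi A)%:R * (\prod_(i in A) x i) * (\prod_(i in ~: A) (1 - x i)).

Definition diag_section (R : realType) (n : nat) (phi : {set 'I_n} -> bool) :
    {poly R} :=
  reliability phi (fun=> 'X).

(* a_0 X^m + a_1 X^(m-1) + ... + a_m; meaningful for f of degree at most m. *)
Definition reflect_poly (K : nzRingType) (m : nat) (f : {poly K}) : {poly K} :=
  \poly_(i < m.+1) f`_(m - i).

(* p((t - 1) x + 1) as a polynomial in the outer variable t = 'X, whose
   coefficients are polynomials in the inner variable x = 'Y = 'X%:P. *)
Definition subst_tx (R : realType) (p : {poly R}) : {poly {poly R}} :=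
  p^:P \Po (('X - 1) * 'Y + 1).

Section Lifetimes.
Context (R : realType) (n : nat).

(* Max over the working sets A of the min of the t_i, i in A.  The maximum and
   the minima are taken in \bar R only to have units for empty families; for a
   semicoherent phi no family is empty and the result is a real number. *)
Definition system_lifetime (phi : {set 'I_n} -> bool) (t : 'I_n -> R) : \bar R :=
  \big[maxe/-oo%E]_(A : {set 'I_n} | phi A) \big[mine/+oo%E]_(i in A) (t i)%:E.

(* k-th smallest of the t_i, for 1 <= k <= n. *)
Definition order_stat (t : 'I_n -> R) (k : nat) : R :=
  nth 0 (sort <=%R [seq t i | i <- enum 'I_n]) k.-1.

Context (d : measure_display) (Omega : measurableType d).
Context (P : probability Omega R) (T : 'I_n -> {RV P >-> R}).

Definition mutually_independent : Prop :=
  forall (J : {set 'I_n}) (B : 'I_n -> set R), (forall i, measurable (B i)) ->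
    P [set w | forall i, i \in J -> B i (T i w)] =
    (\prod_(i in J) P (T i @^-1` B i))%E.

(* Quantified over measurable sets only: the value of a measure on a
   non-measurable set is unspecified. *)
Definition identically_distributed : Prop :=
  forall (i j : 'I_n) (B : set R), measurable B ->
    distribution P (T i) B = distribution P (T j) B.

Definition continuously_distributed : Prop :=
  forall i : 'I_n, continuous (cdf (T i)).

Definition signature (phi : {set 'I_n} -> bool) (k : nat) : R :=
  fine (P [set w | system_lifetime phi (fun i => T i w) =
                   (order_stat (fun i => T i w) k)%:E]).

Definition tail_signature (phi : {set 'I_n} -> bool) (k : nat) : R :=
  \sum_(k.+1 <= i < n.+1) signature phi i.

End Lifetimes.

(* Main.v *)
Require Import Defs.
From mathcomp Require Import perm measurable_realfun ring zify.

Set Implicit Arguments.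
Unset Strict Implicit.
Unset Printing Implicit Defensive.

Local Open Scope classical_set_scope.
Local Open Scope ring_scope.

(** Both sides of each identity are computed from the numbers [w_m] of path
sets with [m] elements (the [A] with [#|A| = m] and [phi A]), through the
ratios [p_m = w_m / 'C(n, m)], so that [p_m] is the probability that a
uniformly chosen [m]-set of components makes the system work.

Integral side.  Grouping the defining sum of the reliability function by the
size of [A], the diagonal section has Bernstein form
[h = \sum_m w_m X^m (1 - X)^(n - m)].  Reflection is multiplicative, and it
exchanges the coefficients of each linear factor, so it sends
[X^m (1 - X)^(n - m)] to [(X - 1)^(n - m)]; replacing [X] by [(t - 1) x + 1]
gives [((t - 1) x)^(n - m)], and the reflection in [t] gives
[t^m (1 - t)^(n - m) x^(n - m)] ([reflect_subst_bernstein]).  The integral over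
[t] is then a Beta integral, equal to [x^(n - m) / ((n + 1) 'C(n, m))], and the
first right-hand side is [\sum_m p_m x^(n - m)].  The derivative [h'] again has
a Bernstein form, now in degree [n - 1], with coefficients
[(m + 1) w_(m+1) - (n - m) w_m]; after the same computation these become
[p_(m+1) - p_m] ([bernstein_deriv_coef]).

Probabilistic side.  For pairwise distinct lifetimes, for each [m <= n] there
is exactly one [m]-set of components that outlives all the others, called
[upper] below.  The system fails at the [k]-th failure exactly when the upper
set of size [n - k + 1] is a path set and that of size [n - k] is not
([system_lifetime_order_stat]).  Ties have probability zero because the
distributions have no atoms, and the upper set of size [m] is uniformly
distributed because the lifetimes are exchangeable; hence it is a path set with
probability [p_m] ([probability_upper_works]).  As [phi] is monotone,
[s_k = p_(n-k+1) - p_(n-k)] ([signatureE]); the sum telescopes, with [p_0 = 0],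
to the tail signature [p_(n-k)] ([tail_signatureE]).  Comparing coefficients
gives both identities. *)

(** * Reflection of polynomials in Bernstein form *)

Section Reflection.
Context {K : comNzRingType}.
Implicit Types (p : {poly K}) (m : nat).

Lemma coef_reflect_poly m p k :
  (reflect_poly m p)`_k = if (k <= m)%N then p`_(m - k) else 0.
Proof. by rewrite coef_poly. Qed.

Lemma reflect_poly_sum m (I : Type) (r : seq I) (c : I -> K)
    (F : I -> {poly K}) :
  reflect_poly m (\sum_(i <- r) c i *: F i) =
  \sum_(i <- r) c i *: reflect_poly m (F i).
Proof.
apply/polyP => k; rewrite coef_reflect_poly !coef_sum.
under [RHS]eq_bigr do rewrite coefZ coef_reflect_poly.
case: ifP => _; last by rewrite big1// => i _; rewrite mulr0.
by apply: eq_bigr => i _; rewrite coefZ.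
Qed.

(** Reflection in degree [m] is [f(X) |-> X^m f(1/X)], hence multiplicative when
degrees add up; on linear factors it exchanges the two coefficients. All the
reflections needed here follow from this one-factor case. *)
Lemma reflect_poly_mul_linear m p (a b : K) : (size p <= m.+1)%N ->
  reflect_poly m.+1 (p * (a%:P + b *: 'X)) =
  reflect_poly m p * (a *: 'X + b%:P).
Proof.
move=> sp; have p_m1 : p`_m.+1 = 0 by exact/leq_sizeP/leqnn.
apply/polyP => k; rewrite coef_reflect_poly !mulrDr !coefD -!scalerAr !coefZ.
rewrite !coefMC !coefMX !coef_reflect_poly.
case: k => [|k]; first by rewrite !subn0/= p_m1 mul0r !mulr0 mulrC.
rewrite subSS/= ltnS; case: (leqP k m) => [km|mk]; last first.
  by rewrite ltnNge (ltnW mk)/= mulr0 mul0r addr0.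
rewrite mulrC; congr (_ + _); rewrite mulrC.
case: (ltngtP k m) km => // [lt_km|->] _; last by rewrite subnn/= mul0r.
by rewrite subn_eq0 leqNgt lt_km/= -subnS.
Qed.

Lemma size_mul_linear_exp m p (a b : K) j : (size p <= m.+1)%N ->
  (size (p * (a%:P + b *: 'X) ^+ j)%R <= (m + j).+1)%N.
Proof.
move=> sp; elim: j => [|j IH]; first by rewrite mulr1 addn0.
rewrite exprS mulrCA; apply: (leq_trans (size_polyMleq _ _)).
have s2 : (size (a%:P + b *: 'X)%R <= 2)%N.
  rewrite (leq_trans (size_polyD _ _))// geq_max.
  rewrite (leq_trans (size_polyC_leq1 _))//=.
  by rewrite (leq_trans (size_scale_leq _ _))// size_polyX.
by rewrite -subn1 leq_subLR !addnS; exact: leq_add s2 IH.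
Qed.

Lemma reflect_poly_mul_linear_exp m p (a b : K) j : (size p <= m.+1)%N ->
  reflect_poly (m + j) (p * (a%:P + b *: 'X) ^+ j) =
  reflect_poly m p * (a *: 'X + b%:P) ^+ j.
Proof.
move=> sp; elim: j => [|j IH]; first by rewrite addn0 !mulr1.
rewrite addnS !exprSr !mulrA reflect_poly_mul_linear ?IH//.
exact: size_mul_linear_exp.
Qed.

Lemma reflect_poly0_1 : reflect_poly 0 (1 : {poly K}) = 1.
Proof. by apply/polyP => -[|k]; rewrite coef_reflect_poly !coef1. Qed.

(** Both reflections of the theorem have this shape: the inner one over [R] with
factors [X] and [1 - X], the outer one over [{poly R}] with factors [1] (which
reflects to the variable) and [(X - 1) x]. *)
Lemma reflect_poly_linear_exp2 (a b c e : K) i j :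
  reflect_poly (i + j) ((a%:P + b *: 'X) ^+ i * (c%:P + e *: 'X) ^+ j) =
  (a *: 'X + b%:P) ^+ i * (c *: 'X + e%:P) ^+ j.
Proof.
have s1 : (size (1%R : {poly K}) <= 1)%N by rewrite size_poly1.
rewrite -[in LHS](mul1r (_ ^+ i)) -[in LHS](add0n i).
rewrite reflect_poly_mul_linear_exp; last exact: size_mul_linear_exp.
by rewrite reflect_poly_mul_linear_exp// reflect_poly0_1 mul1r.
Qed.

End Reflection.

Section Bernstein.
Context {R : realType}.

Definition bernstein_form m (c : nat -> R) : {poly R} :=
  \sum_(i < m.+1) c i *: ('X^i * (1 - 'X) ^+ (m - i)).

Lemma reflect_poly_bernstein m (c : nat -> R) :
  reflect_poly m (bernstein_form m c) =
  \sum_(i < m.+1) c i *: ('X - 1) ^+ (m - i).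
Proof.
rewrite reflect_poly_sum; apply: eq_bigr => i _; congr (_ *: _).
rewrite -[in reflect_poly m](subnKC (leq_ord i)).
have -> : 'X^i * (1 - 'X) ^+ (m - i) =
    (0%:P + 1 *: 'X) ^+ i * (1%:P + (-1) *: 'X) ^+ (m - i) :> {poly R}.
  by rewrite add0r scale1r scaleN1r.
by rewrite reflect_poly_linear_exp2 scale0r add0r scale1r expr1n mul1r rmorphN.
Qed.

Lemma subst_tx_sum m (c : nat -> R) :
  subst_tx (\sum_(i < m.+1) c i *: ('X - 1) ^+ (m - i)) =
  \sum_(i < m.+1) (c i)%:P *: (('X - 1) * 'Y) ^+ (m - i).
Proof.
rewrite /subst_tx !rmorph_sum/=; apply: eq_bigr => i _.
rewrite map_polyZ comp_polyZ rmorphXn/= rmorphB/= map_polyX rmorph1.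
by rewrite rmorphXn/= rmorphB/= comp_polyX comp_polyC addrK.
Qed.

(** The operation under both integral signs, on a polynomial in Bernstein form:
[X^i (1 - X)^(m - i)] becomes [t^i (1 - t)^(m - i) x^(m - i)]. *)
Lemma reflect_subst_bernstein m (c : nat -> R) (t x : R) :
  (reflect_poly m (subst_tx (reflect_poly m (bernstein_form m c)))).[t, x] =
  \sum_(i < m.+1) c i * x ^+ (m - i) * (t ^+ i * (1 - t) ^+ (m - i)).
Proof.
rewrite reflect_poly_bernstein subst_tx_sum reflect_poly_sum !horner_sum.
apply: eq_bigr => i _.
rewrite -[in reflect_poly m](subnKC (leq_ord i)).
(* The missing factor is written as [(1 + 0 X)^i]: it records that the degree
   bound is [m] and not [m - i], and reflects to [X^i]. *)
have -> : (('X - 1) * 'Y) ^+ (m - i) =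
    (1%:P + 0 *: 'X) ^+ i * ((- 'X)%:P + 'X *: 'X) ^+ (m - i) 
    :> {poly {poly R}}.
  rewrite scale0r addr0 expr1n mul1r mulrBl mul1r mulrC -mul_polyC.
  congr (_ ^+ _).
  by rewrite rmorphN addrC.
rewrite reflect_poly_linear_exp2 scale1r polyC0 addr0.
have -> : - 'X *: 'X + 'Y = (1 - 'X) * 'Y :> {poly {poly R}}.
  by rewrite mulrBl mul1r mulrC -mul_polyC rmorphN mulNr addrC mulrC.
rewrite exprMn !(hornerE, horner_exp)/=; ring.
Qed.

(** Term by term, [\int_0^1 t^i (1 - t)^(m - i) dt] is the Beta value
[i! (m - i)! / (m + 1)!], that is [1 / ((m + 1) 'C(m, i))]. *)
Lemma integral_reflect_subst_bernstein m (a : R) (c : nat -> R) (x : R) :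
  \int[lebesgue_measure]_(t in `[0, 1])
    (a * (reflect_poly m
            (subst_tx (reflect_poly m (bernstein_form m c)))).[t, x]) =
  \sum_(i < m.+1) a * c i / (m.+1%:R * 'C(m, i)%:R) * x ^+ (m - i).
Proof.
pose f (i : 'I_m.+1) (t : R) : R := a * c i * x ^+ (m - i) * XMonemX i (m - i) t.
have intf i : lebesgue_measure.-integrable `[0, 1] (EFin \o f i).
  rewrite (_ : EFin \o f i = (fun t => (a * c i * x ^+ (m - i))%:E *
    (EFin \o XMonemX i (m - i)) t)%E); last first.
    by apply/funext => t; rewrite /= -EFinM.
  by apply: integrableZl => //; exact: integrable_XMonemX.
transitivity (fine (\int[lebesgue_measure]_(t in `[0%R, 1%R])
    \sum_(i < m.+1) (f i t)%:E)%E).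
  congr fine; apply: eq_integral => t _; rewrite sumEFin; congr EFin.
  rewrite reflect_subst_bernstein mulr_sumr; apply: eq_bigr => i _.
  by rewrite /f /XMonemX -!mulrA.
rewrite integral_sum// -sum_fine; last first.
  by move=> i _; exact: (integrable_fin_num _ (intf i)).
apply: eq_bigr => i _.
rewrite -[LHS]/(\int[lebesgue_measure]_(t in `[0, 1]) f i t).
rewrite RintegralZl//; last exact: integrable_XMonemX.
have -> : \int[lebesgue_measure]_(t in `[0, 1]) XMonemX i (m - i) t =
    beta_fun i.+1 (m - i).+1 :> R by rewrite Rintegral_mkcond.
rewrite beta_fun_fact subnKC ?leq_ord// -mulrA [x ^+ _ * _]mulrC mulrA.
congr (_ * _); congr (_ * _).
rewrite factS natrM -(bin_fact (leq_ord i)) !natrM.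
have nz k : k`!%:R != 0 :> R by rewrite pnatr_eq0 -lt0n fact_gt0.
have bnz : 'C(m, i)%:R != 0 :> R by rewrite pnatr_eq0 -lt0n bin_gt0 leq_ord.
by field; rewrite !nz bnz -mulrS pnatr_eq0.
Qed.

(** The product rule on [X^i (1 - X)^(m + 1 - i)] yields one term with [i - 1]
and one with [i] factors [X]; the coefficient of [X^i (1 - X)^(m - i)] collects
the first from index [i + 1] and the second from index [i]. *)
Lemma deriv_bernstein_form m (c : nat -> R) :
  (bernstein_form m.+1 c)^`() =
  bernstein_form m
    (fun i => i.+1%:R * c i.+1 - (m.+1 - i)%:R * c i).
Proof.
rewrite /bernstein_form raddf_sum/=.
under eq_bigr do rewrite derivZ derivM derivXn deriv_exp derivB derivX
  -[1]polyC1 derivC polyC1 sub0r mulN1r.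
under eq_bigr do rewrite scalerDr.
rewrite big_split/= big_ord_recl/= mulr0n mul0r scaler0 add0r.
under eq_bigr do rewrite subSS.
rewrite [X in _ + X]big_ord_recr/= subnn mulr0n mulr0 scaler0 addr0 -big_split/=.
apply: eq_bigr => i _; rewrite /bump leq0n add1n add0n scalerBl subSn ?leq_ord//=.
rewrite ![_%:R * _]mulrC -!scalerA !scaler_nat; congr (_ *: _ + _).
  by rewrite mulrnAl.
by rewrite -scalerN; congr (_ *: _); rewrite mulrnAr mulrN mulNrn.
Qed.

End Bernstein.

Section PathSetCounts.
Context {n : nat} (phi : {set 'I_n} -> bool).

Definition path_sets m : {set {set 'I_n}} := [set A | phi A & #|A| == m]%SET.

Lemma diag_section_bernstein (R : realType) :
  diag_section R phi = bernstein_form n (fun m => #|path_sets m|%:R).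
Proof.
have card_lt (A : {set 'I_n}) : (#|A| < n.+1)%N.
  by rewrite ltnS -[X in (_ <= X)%N]card_ord max_card.
rewrite /diag_section /reliability.
rewrite (partition_big (fun A : {set 'I_n} => Ordinal (card_lt A)) predT)//=.
apply: eq_bigr => m _.
transitivity (\sum_(A in path_sets m) 'X^m * (1 - 'X) ^+ (n - m) : {poly R}).
  rewrite [LHS]big_mkcond [RHS]big_mkcond; apply: eq_bigr => A _.
  rewrite inE -val_eqE/=; case: (#|A| =P m) => [<-|_]; last by rewrite andbF.
  rewrite andbT !prodr_const [#|~: A|%SET]cardsCs finset.setCK card_ord.
  by case: (phi A); rewrite ?mul1r// !mul0r.
by rewrite sumr_const scaler_nat.
Qed.

End PathSetCounts.

(** * Order statistics and system lifetime of a lifetime vector *)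

Section OrderStatistics.
Context {R : realType} {n : nat}.
Implicit Types (t : 'I_n -> R) (c : R) (A B : {set 'I_n}).

Definition exceeding t c : {set 'I_n} := [set i | c < t i]%SET.
Definition surviving t c : {set 'I_n} := [set i | c <= t i]%SET.

Lemma count_surviving t c :
  count (< c) [seq t i | i <- enum 'I_n] = #|~: surviving t c|.
Proof.
rewrite count_map cardE -size_filter enumT; congr size; apply: eq_filter => i.
by rewrite !inE/= -ltNge.
Qed.

Lemma count_exceeding t c :
  count (<= c) [seq t i | i <- enum 'I_n] = #|~: exceeding t c|.
Proof.
rewrite count_map cardE -size_filter enumT; congr size; apply: eq_filter => i.
by rewrite !inE/= -leNgt.
Qed.

Lemma order_stat_codom t k : (k < n)%N -> exists j, order_stat t k.+1 = t j.
Proof.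
move=> kn; have : order_stat t k.+1 \in sort <=%R [seq t i | i <- enum 'I_n].
  by rewrite mem_nth// size_sort size_map size_enum_ord.
by rewrite mem_sort => /mapP[j _ ->]; exists j.
Qed.

(** The order statistic is characterised by two cardinals, without sorting. This
makes its measurability and its position among distinct lifetimes accessible. *)
Lemma order_stat_eq t k j : (k < n)%N ->
  (order_stat t k.+1 == t j) =
  (#|~: surviving t (t j)| <= k < #|~: exceeding t (t j)|)%N.
Proof.
move=> kn; rewrite -count_surviving -count_exceeding /order_stat/=.
set s := map _ _; have s_sorted := sort_le_sorted s.
have perm p : count p (sort <=%R s) = count p s.
  by apply/seq.permP; rewrite perm_sort.
rewrite -!perm; apply/eqP/andP => [eq_j|[lek ltk]]; last first.
  by apply: nth_count_eq => //; rewrite lek.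
split; rewrite leqNgt; apply/negP => lt.
  by have := nth_count_lt 0 s_sorted lt; rewrite eq_j ltxx.
have /(nth_count_gt 0 s_sorted) :
    (count (<= t j) (sort <=%R s) <= k < size (sort <=%R s))%N.
  by rewrite -ltnS lt size_sort size_map size_enum_ord.
by rewrite eq_j ltxx.
Qed.

(** When the lifetimes are distinct, these are the sets of components still
operating at some time. *)
Definition upper t A := [forall i in A, forall j in ~: A, t j < t i].

Lemma upperP t A :
  reflect (forall i j, i \in A -> j \notin A -> t j < t i) (upper t A).
Proof.
apply: (iffP forall_inP) => [up i j iA jA|up i iA].
  by apply: (forall_inP (up i iA)); rewrite inE.
by apply/forall_inP => j; rewrite inE; exact: up.
Qed.

(** Upper sets form a chain: if [i] is in [A] only and [j] in [B] only, then
[t j < t i] and [t i < t j]. *)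
Lemma upper_subset t A B : upper t A -> upper t B -> (#|A| <= #|B|)%N ->
  A \subset B.
Proof.
move=> /upperP upA /upperP upB; apply: contraTT => /subsetPn[i iA iB].
rewrite -ltnNge; apply/proper_card/properP; split; last by exists i.
apply/fintype.subsetP => j jB; apply: contraT => jA.
by have := lt_trans (upA _ _ iA jA) (upB _ _ jB iB); rewrite ltxx.
Qed.

Lemma upper_inj t A B : upper t A -> upper t B -> #|A| = #|B| -> A = B.
Proof.
move=> upA upB AB; apply/eqP; rewrite finset.eqEsubset.
by rewrite !(@upper_subset t)// AB.
Qed.

Lemma upper_exceeding t c : upper t (exceeding t c).
Proof. by apply/upperP => i j; rewrite !inE -leNgt => ci /le_lt_trans; apply. Qed.

Lemma upper_surviving t c : upper t (surviving t c).
Proof. by apply/upperP => i j; rewrite !inE -ltNge => ci /lt_le_trans; apply. Qed.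

(** At the failure of index [k] (from zero) the components still alive just before number [n - k], and one less just after, as no two fail together. *)
Lemma card_order_stat t k : injective t -> (k < n)%N ->
  #|surviving t (order_stat t k.+1)| = (n - k)%N /\
  #|exceeding t (order_stat t k.+1)| = (n - k.+1)%N.
Proof.
move=> t_inj kn; have [j tj] := order_stat_codom t kn.
have /esym := order_stat_eq t j kn; rewrite tj eqxx => /andP[lek ltk].
have E : surviving t (t j) = j |: exceeding t (t j).
  by apply/finset.setP => i; rewrite !inE le_eqVlt (inj_eq t_inj) eq_sym.
have card_S : #|surviving t (t j)| = #|exceeding t (t j)|.+1.
  by rewrite E cardsU1 inE ltxx.
have := cardsC (surviving t (t j)); have := cardsC (exceeding t (t j)).
rewrite card_ord; move: lek ltk card_S.
move: #|_| #|_| #|_| #|_| => a b c e; lia.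
Qed.

Lemma exists_upper t m : injective t -> (m <= n)%N ->
  exists2 A : {set 'I_n}, upper t A & #|A| = m.
Proof.
move=> t_inj; rewrite leq_eqVlt => /orP[/eqP->|mn].
  exists [set: 'I_n]%SET; last by rewrite cardsT card_ord.
  by apply/upperP => i j _; rewrite inE.
have lt : (n - m.+1 < n)%N by lia.
exists (exceeding t (order_stat t (n - m.+1).+1)); first exact: upper_exceeding.
by have [_ ->] := card_order_stat t_inj lt; lia.
Qed.

End OrderStatistics.

Section SystemLifetime.
Context {R : realType} {n : nat}.
Implicit Types (t : 'I_n -> R) (c : R) (A B : {set 'I_n}).
Variable phi : {set 'I_n} -> bool.
Hypothesis phi_incr : forall A i, phi A -> phi (i |: A)%SET.

Lemma structure_subset A B : A \subset B -> phi A -> phi B.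
Proof.
move=> /finset.setUidPr <-; rewrite finset.setUC -[B]set_enum.
elim: (enum B) => [|i s IH] phiA; first by rewrite finset.set_nil finset.set0U.
by rewrite finset.set_cons -finset.setUA phi_incr// IH.
Qed.

(** Some path set outlives [c] iff the set of all components outliving [c] is
itself a path set, by monotonicity; likewise with strict inequality. *)
Lemma system_lifetime_ge t c :
  (c%:E <= system_lifetime phi t)%E = phi (surviving t c).
Proof.
apply/idP/idP => [|phiS]; last first.
  apply: le_trans (le_bigmax_cond _ _ phiS).
  by apply/bigmin_geP; split => [|i]; rewrite ?leey// inE lee_fin.
apply: contraTT => nphi; rewrite -ltNge; apply/bigmax_ltP; split => [|A phiA].
  by rewrite ltNyr.
rewrite ltNge; apply: contra nphi => /bigmin_geP[_ le_c].
apply: structure_subset phiA; apply/fintype.subsetP => i iA.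
by rewrite inE -lee_fin le_c.
Qed.

Lemma system_lifetime_gt t c :
  (c%:E < system_lifetime phi t)%E = phi (exceeding t c).
Proof.
apply/idP/idP => [|phiS]; last first.
  rewrite ltNge; apply/negP => /bigmax_leP[_ /(_ _ phiS)].
  apply/negP; rewrite -ltNge.
  by apply/bigmin_gtP; split => [|i]; rewrite ?ltry// inE lte_fin.
apply: contraTT => nphi; rewrite -leNgt; apply/bigmax_leP; split => [|A phiA].
  by rewrite leNye.
rewrite leNgt; apply: contra nphi => /bigmin_gtP[_ lt_c].
apply: structure_subset phiA; apply/fintype.subsetP => i iA.
by rewrite inE -lte_fin lt_c.
Qed.

Lemma system_lifetime_eq t c :
  system_lifetime phi t = c%:E <->
  phi (surviving t c) && ~~ phi (exceeding t c).
Proof.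
rewrite -system_lifetime_ge -system_lifetime_gt -leNgt andbC -eq_le.
by split => [->|/eqP].
Qed.

(** For distinct lifetimes this says that the unique upper set of size [m] is a
path set; the existential form makes sense, and is measurable, in general. *)
Definition upper_works t m := [exists A in path_sets phi m, upper t A].

Lemma upper_worksE t A : upper t A -> upper_works t #|A| = phi A.
Proof.
move=> upA; apply/exists_inP/idP => [[B]|phiA]; last first.
  by exists A => //; rewrite inE phiA eqxx.
by rewrite inE => /andP[phiB /eqP eqAB] upB; rewrite -(upper_inj upB upA eqAB).
Qed.

(** The system dies at a given failure iff it works with the survivors just before
that failure and not with those just after it. *)
Lemma system_lifetime_order_stat t k : injective t -> (k < n)%N ->
  system_lifetime phi t = (order_stat t k.+1)%:E <->
  upper_works t (n - k)%N && ~~ upper_works t (n - k.+1)%N.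
Proof.
move=> t_inj kn; have [<- <-] := card_order_stat t_inj kn.
rewrite !upper_worksE; first exact: system_lifetime_eq.
- exact: upper_exceeding.
- exact: upper_surviving.
Qed.

Lemma upper_works_leq t m l : injective t -> (m <= l <= n)%N ->
  upper_works t m -> upper_works t l.
Proof.
move=> t_inj /andP[ml ln] /exists_inP[A]; rewrite inE => /andP[phiA /eqP Am] upA.
have [B upB Bl] := exists_upper t_inj ln.
rewrite -Bl upper_worksE//; apply: structure_subset phiA.
by apply: (upper_subset upA upB); rewrite Am Bl.
Qed.

End SystemLifetime.

(** * Measurability of events defined by comparing lifetimes *)

Section MeasurableOrderEvents.
Context {d : measure_display} {Omega : measurableType d}.

Lemma measurable_bool_set (f : Omega -> bool) :
  measurable_fun setT f -> measurable [set w | f w].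
Proof. by move=> /(_ measurableT [set true] I); rewrite setTI. Qed.

(** The random set [[set i | f i w]] takes finitely many values, so any property
of it is a finite union of finite intersections of the events [f i] and their
complements. Every event below is expressed through such random sets. *)
Lemma measurable_fun_finset (I : finType) (f : I -> Omega -> bool)
    (Q : {set I} -> bool) : (forall i, measurable_fun setT (f i)) ->
  measurable_fun setT (fun w => Q [set i | f i w]%SET).
Proof.
move=> mf; apply: (measurable_fun_bool true); rewrite setTI.
rewrite [X in measurable X](_ : _ = \bigcup_(A in [set A | Q A])
    \bigcap_(i in setT) [set w | f i w == (i \in A)]).
  apply: fin_bigcup_measurable => [|A _]; first exact: finite_finset.
  apply: fin_bigcap_measurable => [|i _]; first exact: finite_finset.
  apply: measurable_bool_set; case: (i \in A).
    by under eq_fun do rewrite eqb_id; exact: mf.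
  by under eq_fun do rewrite eqbF_neg; exact: measurable_neg.
apply/seteqP; split => [w /= Qw|w [A /= QA wA]].
  exists [set i | f i w]%SET; first exact: Qw.
  by move=> i _; rewrite /mkset inE.
rewrite -[RHS]QA; congr Q; apply/finset.setP => i.
by rewrite inE; apply/eqP/wA.
Qed.

Context {R : realType} {n : nat} (T : 'I_n -> Omega -> R).
Hypothesis mT : forall i, measurable_fun setT (T i).

Lemma measurable_fun_upper (A : {set 'I_n}) :
  measurable_fun setT (fun w => upper (T ^~ w) A).
Proof.
rewrite (_ : (fun _ => _) = fun w =>
    [forall i in A, forall j in ~: A,
      (j, i) \in [set ij : 'I_n * 'I_n | T ij.1 w < T ij.2 w]%SET]).
  apply: (@measurable_fun_finset _ (fun ij w => T ij.1 w < T ij.2 w)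
    (fun L => [forall i in A, forall j in ~: A, (j, i) \in L])) => ij.
  exact: measurable_fun_ltr.
apply/funext => w; apply: eq_forallb => i; congr (_ ==> _).
by apply: eq_forallb => j; congr (_ ==> _); rewrite inE.
Qed.

Lemma measurable_injective : measurable [set w | injective (T ^~ w)].
Proof.
rewrite (_ : [set w | _] = [set w | [forall ij : 'I_n * 'I_n,
    (T ij.1 w == T ij.2 w) ==> (ij.1 == ij.2)]]); last first.
  apply/seteqP; split => w /=.
    by move=> inj; apply/forallP => ij; apply/implyP => /eqP eqT; apply/eqP/inj.
  move=> /forallP inj i j eqT; have /implyP := inj (i, j).
  by rewrite eqT eqxx => /(_ isT)/eqP.
apply: measurable_bool_set.
rewrite (_ : (fun _ => _) = fun w => [forall ij, (ij \in
    [set ij : 'I_n * 'I_n | T ij.1 w == T ij.2 w]%SET) ==> (ij.1 == ij.2)]).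
  apply: (@measurable_fun_finset _ (fun ij w => T ij.1 w == T ij.2 w)
    (fun L => [forall ij, (ij \in L) ==> (ij.1 == ij.2)])) => ij.
  exact: measurable_fun_eqr.
by apply/funext => w; apply: eq_forallb => ij; rewrite inE.
Qed.

(** The value of a measure on a non-measurable set being unspecified, the event
defining the signature has to be proved measurable, ties included. Splitting on
the index [j] that realises the order statistic reduces it to the random sets
of components surviving [T j]. *)
Lemma measurable_system_lifetime_order_stat (phi : {set 'I_n} -> bool) k :
  (forall A i, phi A -> phi (i |: A)%SET) -> (k < n)%N ->
  measurable [set w | system_lifetime phi (T ^~ w) =
                      (order_stat (T ^~ w) k.+1)%:E].
Proof.
move=> phi_incr kn.
have mS (Q : {set 'I_n} -> bool) j :
    measurable_fun setT (fun w => Q (surviving (T ^~ w) (T j w))).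
  apply: measurable_fun_finset => i; exact: measurable_fun_ler.
have mE (Q : {set 'I_n} -> bool) j :
    measurable_fun setT (fun w => Q (exceeding (T ^~ w) (T j w))).
  apply: measurable_fun_finset => i; exact: measurable_fun_ltr.
pose f j w := (order_stat (T ^~ w) k.+1 == T j w) &&
  (phi (surviving (T ^~ w) (T j w)) && ~~ phi (exceeding (T ^~ w) (T j w))).
rewrite [X in measurable X](_ : _ = \bigcup_(j in [set: 'I_n]) [set w | f j w]).
  apply: fin_bigcup_measurable => [|j _]; first exact: finite_finset.
  apply: measurable_bool_set; apply: measurable_and; last first.
    by apply: measurable_and => //; exact: (mE (fun A => ~~ phi A)).
  under eq_fun do rewrite order_stat_eq//.
  apply: measurable_and; first exact: (mS (fun A => #|~: A| <= k)%N).
  exact: (mE (fun A => k < #|~: A|)%N).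
apply/seteqP; split => [w /=|w [j _ /= /andP[/eqP ->]]].
  have [j tj] := order_stat_codom (T ^~ w) kn.
  rewrite system_lifetime_eq// tj => phij; exists j => //.
  by rewrite /mkset /f tj eqxx.
by move=> /(system_lifetime_eq phi_incr) ->.
Qed.

End MeasurableOrderEvents.

(** * Ties and exchangeability of i.i.d. lifetimes *)

(** If [{x}] had mass [p > 0], continuity would give [y < x] with
[F(y) > F(x) - p], whereas [F(y) + p <= F(x)]. *)
Lemma continuous_cdf_atomless (R : realType) (d : measure_display)
    (Omega : measurableType d) (P : probability Omega R) (X : {RV P >-> R})
    (x : R) : continuous (cdf X) -> distribution P X [set x] = 0%E.
Proof.
move=> cX; apply/eqP; rewrite -measure_le0 leNgt; apply/negP => p_gt0.
have fin_cdf y : cdf X y \is a fin_num by exact: fin_num_measure.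
have fin_p : distribution P X [set x] \is a fin_num by exact: fin_num_measure.
have lt_cdf : (cdf X x - distribution P X [set x] < cdf X x)%E.
  by rewrite lteBlDr// lteDl.
have /nbhs_ballP[e /= e_gt0 ball_lt] := cX x _ (open_ereal_gt' lt_cdf).
have e2_gt0 : 0 < e / 2 by rewrite divr_gt0.
pose y := x - e / 2.
have : ball x e y.
  rewrite /ball/= /y opprB addrC subrK gtr0_norm//.
  by rewrite ltr_pdivrMr// mulr_natr mulr2n ltrDl.
move=> /ball_lt /=; rewrite lteBlDr// ltNge => /negP; apply.
rewrite /cdf -measureU//; last first.
  apply/seteqP; split => // z [/= + zx]; rewrite zx in_itv/= /y.
  by rewrite leNgt ltrBlDr ltrDl e2_gt0.
apply: le_measure; rewrite ?inE//=; first exact: measurableU.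
move=> z [/=|->]; last by rewrite /= in_itv/= lexx.
rewrite !in_itv/= => /le_trans; apply.
by rewrite /y lerBlDr lerDl ltW.
Qed.

Section TupleLaw.
Context {R : realType} {n : nat}.

Definition box (B : 'I_n -> set R) : set (n.-tuple R) :=
  [set t | forall i, B i (tnth t i)].

Lemma measurable_box B : (forall i, measurable (B i)) -> measurable (box B).
Proof.
move=> mB; rewrite (_ : box B =
    \bigcap_(i in [set: 'I_n]) (fun t => tnth t i) @^-1` B i).
  apply: fin_bigcap_measurable => [|i _]; first exact: finite_finset.
  by rewrite -[X in measurable X]setTI; apply: measurable_tnth.
by apply/seteqP; split => [t Bt i _|t Bt i]; [exact: Bt|exact: Bt].
Qed.

Lemma measurable_tuple_boxes : @measurable _ (n.-tuple R) =
  <<s [set X | exists2 B, forall i, measurable (B i) & X = box B] >>.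
Proof.
apply/seteqP; split; last first.
  apply: smallest_sub; first exact: sigma_algebra_measurable.
  by move=> _ [B mB ->]; exact: measurable_box.
apply: smallest_sub; first exact: smallest_sigma_algebra.
move=> X; rewrite -bigcup_seq/= => -[i _ [B mB <-]].
apply: sub_sigma_algebra.
exists (fun j => if j == i then B else setT).
  by move=> j; case: ifP.
apply/seteqP; split => [t [_ Bt] j|t Bt].
  by case: eqP => [->|].
by split => //; have := Bt i; rewrite eqxx.
Qed.

(** Boxes form a pi-system generating the product sigma-algebra, so a finite
measure on vectors is determined by its values on them. *)
Lemma eq_measure_boxes (m1 m2 : {measure set (n.-tuple R) -> \bar R}) :
  (m1 setT < +oo)%E ->
  (forall B, (forall i, measurable (B i)) -> m1 (box B) = m2 (box B)) ->
  forall X, measurable X -> m1 X = m2 X.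
Proof.
move=> fin12 m12.
apply: (measure_unique _ (fun=> setT) measurable_tuple_boxes).
- move=> _ _ [B mB ->] [C mC ->]; exists (fun i => B i `&` C i).
    by move=> i; exact: measurableI.
  apply/seteqP; split => [t [Bt Ct] i|t BCt]; first by split; [exact: Bt|exact: Ct].
  by split => i; have [] := BCt i.
- by move=> _; exists (fun=> setT) => //; apply/seteqP; split.
- by apply/seteqP; split => // t _; exists 0%N.
- by move=> _ [B mB ->]; exact: m12.
- by move=> _.
Qed.

End TupleLaw.

Section IndependentLifetimes.
Context {R : realType} {d : measure_display} {Omega : measurableType d}.
Context {P : probability Omega R} {n : nat} (T : 'I_n -> {RV P >-> R}).
Hypothesis T_indep : mutually_independent T.

(** By independence the law of [(T i, T j)] is the product of the marginals, and
by Fubini the diagonal has measure the integral of the masses of the points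
[x], all zero. *)
Lemma tie_null i j : i != j -> continuous (cdf (T j)) ->
  P [set w | T i w = T j w] = 0%E.
Proof.
move=> ij cTj.
have mf : measurable_fun setT (fun w => (T i w, T j w)).
  by apply: measurable_fun_pair.
pose X : {mfun Omega >-> (R * R)%type} := mfun_Sub (mem_set mf).
pose D : set (R * R) := [set x | x.1 == x.2].
have mD : measurable D.
  apply: measurable_bool_set; exact: measurable_fun_eqr.
transitivity (distribution P X D).
  by congr (P _); apply/seteqP; split => w /=; rewrite /D/= => /eqP.
rewrite -(@product_measure_unique _ _ _ _ _ (distribution P (T i))
  (distribution P (T j)) (distribution P X))//; last first.
  move=> A B mA mB.
  have ji : (j == i) = false by rewrite eq_sym (negbTE ij).
  have := @T_indep [set i; j]%SET (fun l => if l == i then A else B).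
  rewrite big_setU1 ?inE// big_set1 eqxx ji => <-; last by move=> l; case: ifP.
  congr (P _); apply/seteqP; split => w /=.
    by move=> [Aw Bw] l; rewrite !inE => /orP[]/eqP->; rewrite ?eqxx ?ji.
  move=> ABw; split.
    by have := ABw i; rewrite !inE !eqxx/=; apply.
  by have := ABw j; rewrite !inE ji !eqxx/=; apply.
rewrite /= /product_measure1 integral0_eq// => x _ /=.
rewrite [xsection D x](_ : _ = [set x]); first exact: continuous_cdf_atomless.
apply/seteqP; split => y; rewrite xsectionE /D/=; first by move=> /eqP.
by move=> ->; exact: eqxx.
Qed.

Lemma distinct_lifetimes : continuously_distributed T ->
  P [set w | injective (T ^~ w)] = 1%E.
Proof.
move=> T_cont.
have minj : measurable [set w | injective (T ^~ w)] by exact: measurable_injective.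
rewrite -[X in P X]setCK probability_setC; last exact: measurableC.
suff -> : P (~` [set w | injective (T ^~ w)]) = 0%E by rewrite sube0.
pose D : set ('I_n * 'I_n) := [set ij | ij.1 != ij.2].
have mtie i j : measurable [set w | T i w = T j w].
  rewrite (_ : [set w | _] = [set w | T i w == T j w]).
    by apply: measurable_bool_set; exact: measurable_fun_eqr.
  by apply/seteqP; split => w /= /eqP.
apply/eqP; rewrite -measure_le0.
apply: (@le_trans _ _ (\sum_(ij \in D) P [set w | T ij.1 w = T ij.2 w])%E).
  apply: content_sub_fsum => //; [exact: finite_finset|exact: measurableC|].
  move=> w /=; apply: contra_notP => noties i j eqT.
  by apply/eqP; apply: contra_notT noties => ij; exists (i, j).
by rewrite fsbig1// => -[i j] /= ij; exact: tie_null.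
Qed.

Hypothesis T_id : identically_distributed T.

Lemma exchangeable_box (s : 'I_n -> 'I_n) B :
  involutive s -> (forall i, measurable (B i)) ->
  P [set w | forall i, B i (T (s i) w)] = P [set w | forall i, B i (T i w)].
Proof.
move=> sK mB.
have indep (C : 'I_n -> set R) : (forall i, measurable (C i)) ->
    P [set w | forall i, C i (T i w)] = (\prod_i P (T i @^-1` C i))%E.
  move=> mC; have := @T_indep [set: 'I_n]%SET C mC.
  rewrite [X in _ = X](eq_bigl xpredT); last by move=> i; rewrite inE.
  by move=> <-; congr (P _); apply/seteqP; split => w /= Cw i *;
  by apply: Cw; rewrite ?inE.
transitivity (P [set w | forall i, B (s i) (T i w)]).
  congr (P _); apply/seteqP; split => w /= Bw i; have := Bw (s i);
  by rewrite sK.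
rewrite (indep (fun i => B (s i)))// indep// [RHS](reindex_inj (inv_inj sK))/=.
by apply: eq_bigr => i _; exact: (T_id i (s i) (mB (s i))).
Qed.

(** Exchangeability: by independence and identical distribution the vectors [T]
and [T \o s] have the same probability on each box. Involutions are enough
here, as transpositions generate all permutations. *)
Lemma exchangeable (s : 'I_n -> 'I_n) (X : set (n.-tuple R)) :
  involutive s -> measurable X ->
  P [set w | X [tuple T (s i) w | i < n]] = P [set w | X [tuple T i w | i < n]].
Proof.
move=> sK mX.
have mf (u : 'I_n -> 'I_n) :
    measurable_fun setT (fun w => [tuple T (u i) w | i < n]).
  apply/measurable_fun_tnthP => i; rewrite (_ : _ \o _ = T (u i))//.
  by apply/funext => w /=; rewrite tnth_mktuple.
pose V u : {mfun Omega >-> n.-tuple R} := mfun_Sub (mem_set (mf u)).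
apply: (@eq_measure_boxes _ _ (distribution P (V s)) (distribution P (V id))) => //.
  by rewrite /= /distribution /pushforward preimage_setT probability_setT ltry.
move=> B mB; have boxE u : V u @^-1` box B = [set w | forall i, B i (T (u i) w)].
  by apply/seteqP; split => w /= + i => /(_ i); rewrite tnth_mktuple.
by have := exchangeable_box sK mB; rewrite -(boxE s) -(boxE id).
Qed.

Lemma upper_exchangeable_involution (s : 'I_n -> 'I_n) (A : {set 'I_n}) :
  involutive s ->
  P [set w | upper (T ^~ w) (s @: A)%SET] = P [set w | upper (T ^~ w) A].
Proof.
move=> sK; pose X : set (n.-tuple R) := [set t | upper (tnth t) A].
have mX : measurable X.
  apply: measurable_bool_set.
  apply: (measurable_fun_upper (T := fun i t => tnth t i)) => i.
  exact: measurable_tnth.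
transitivity (P [set w | X [tuple T (s i) w | i < n]]).
  congr (P _); apply/seteqP; split => w /= /upperP up; apply/upperP => i j iA jA.
    by rewrite !tnth_mktuple up ?mem_imset//; exact: inv_inj.
  have := up (s i) (s j); rewrite !tnth_mktuple !sK; apply.
    by rewrite -(mem_imset _ _ (inv_inj sK)) sK.
  by rewrite -(mem_imset _ _ (inv_inj sK)) sK.
rewrite exchangeable//; congr (P _); apply/seteqP.
by split => w /= /upperP up; apply/upperP => i j iA jA; have := up i j iA jA;
  rewrite !tnth_mktuple.
Qed.

(** Two sets of the same size are linked by transpositions, each exchanging an
element of [A :\: B] with one of [B :\: A]. *)
Lemma upper_exchangeable (A B : {set 'I_n}) : #|A| = #|B| ->
  P [set w | upper (T ^~ w) A] = P [set w | upper (T ^~ w) B].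
Proof.
elim: {A}#|A :\: B|%SET {-2}A (erefl #|A :\: B|%SET) => [|m IH] A cardD cardAB.
  suff -> : A = B by [].
  by apply/eqP; rewrite finset.eqEcard cardAB leqnn andbT -finset.setD_eq0
    -cards_eq0 cardD.
have /card_gt0P[i] : (0 < #|A :\: B|%SET)%N by rewrite cardD.
rewrite inE => /andP[iB iA].
have /subsetPn[j jB jA] : ~~ (B \subset A).
  apply/negP => BA; have /eqP BeqA : B == A.
    by rewrite finset.eqEcard BA cardAB leqnn.
  by rewrite BeqA iA in iB.
have inj := @perm_inj _ (tperm i j).
rewrite -(upper_exchangeable_involution _ (tpermK i j)).
apply: IH; last by rewrite card_imset.
have -> : (tperm i j @: A :\: B = (A :\: B) :\ i)%SET.
  apply/finset.setP => k.
  rewrite !inE -[k](tpermK i j) (mem_imset _ _ inj) tpermK.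
  case: tpermP => [->|->|/eqP ki /eqP kj].
  - by rewrite (negbTE jA) andbF eqxx.
  - by rewrite jB andbF.
  - by rewrite ki.
by have := cardsD1 i (A :\: B)%SET; rewrite !inE iB iA cardD add1n => -[].
Qed.

End IndependentLifetimes.

(** * Signature and tail signature in terms of path sets *)

Section Signature.
Context {R : realType} {d : measure_display} {Omega : measurableType d}.
Context {P : probability Omega R} {n : nat} (T : 'I_n -> {RV P >-> R}).
Hypothesis T_cont : continuously_distributed T.
Hypothesis T_indep : mutually_independent T.
Hypothesis T_id : identically_distributed T.

Let distinct := [set w | injective (T ^~ w)].

Let m_distinct : measurable distinct.
Proof. exact: measurable_injective. Qed.

Let m_upper (A : {set 'I_n}) : measurable [set w | upper (T ^~ w) A].
Proof. exact/measurable_bool_set/measurable_fun_upper. Qed.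

(** Events may be intersected with the almost sure event that there are no ties,
on which the deterministic results apply. *)
Lemma probability_distinct (X : set Omega) : measurable X ->
  P (X `&` distinct) = P X.
Proof.
move=> mX; rewrite [RHS](measureDI P mX m_distinct).
rewrite [X in _ = (X + _)%E](_ : _ = 0%E) ?add0e//.
apply/eqP; rewrite -measure_le0 (@le_trans _ _ (P (~` distinct)))//.
  by apply: le_measure; rewrite ?inE//; [exact: measurableD|exact: measurableC].
by rewrite probability_setC// distinct_lifetimes// subee.
Qed.

Lemma measurable_upper_works (phi : {set 'I_n} -> bool) m :
  measurable [set w | upper_works phi (T ^~ w) m].
Proof.
rewrite (_ : [set w | _] = \bigcup_(A in [set` enum (path_sets phi m)])
    [set w | upper (T ^~ w) A]).
  by apply: fin_bigcup_measurable => // A _.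
apply/seteqP; split => w /=.
  by move=> /exists_inP[A phiA upA]; exists A; rewrite //= mem_enum.
by move=> [A /=]; rewrite mem_enum => phiA upA; apply/exists_inP; exists A.
Qed.

(** The events [upper A], for [A] of a fixed size, are pairwise disjoint even in
the presence of ties. *)
Lemma probability_upper_works_sum (phi : {set 'I_n} -> bool) m :
  P [set w | upper_works phi (T ^~ w) m] =
  (\sum_(A in path_sets phi m) P [set w | upper (T ^~ w) A])%E.
Proof.
rewrite (_ : [set w | _] = \bigcup_(A in [set` enum (path_sets phi m)])
    [set w | upper (T ^~ w) A]); last first.
  apply/seteqP; split => w /=.
    by move=> /exists_inP[A phiA upA]; exists A; rewrite //= mem_enum.
  by move=> [A /=]; rewrite mem_enum => phiA upA; apply/exists_inP; exists A.
rewrite measure_fin_bigcup//; last first.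
  move=> A B /=; rewrite !mem_enum !inE => /andP[_ /eqP Am] /andP[_ /eqP Bm].
  by move=> [w [/= upA upB]]; apply: (upper_inj upA upB); rewrite Am Bm.
by rewrite -fsbig_seq ?enum_uniq// big_enum.
Qed.

Definition upper_works_prob (phi : {set 'I_n} -> bool) m : R :=
  #|path_sets phi m|%:R / 'C(n, m)%:R.

(** All [m]-sets have the same probability [q] of being upper, and almost surely
one of them is; taking every set as a path set shows that [q] is
[1 / 'C(n, m)]. *)
Lemma probability_upper_works (phi : {set 'I_n} -> bool) m : (m <= n)%N ->
  P [set w | upper_works phi (T ^~ w) m] = (upper_works_prob phi m)%:E.
Proof.
move=> mn.
have card_sets : #|@path_sets n xpredT m| = 'C(n, m).
  by have := card_draws 'I_n m; rewrite card_ord.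
have /card_gt0P[A0] : (0 < #|@path_sets n xpredT m|)%N.
  by rewrite card_sets bin_gt0.
rewrite inE => /eqP A0m; pose q := fine (P [set w | upper (T ^~ w) A0]).
have sumE psi : P [set w | upper_works psi (T ^~ w) m] =
    (q *+ #|path_sets psi m|)%:E.
  rewrite probability_upper_works_sum -sumr_const -sumEFin.
  apply: eq_bigr => A; rewrite inE => /andP[_ /eqP Am].
  rewrite /q fineK; last exact: fin_num_measure.
  by apply: upper_exchangeable => //; rewrite Am A0m.
(* [xpredT] as structure function: some [m]-set is upper, almost surely. *)
have : P [set w | upper_works xpredT (T ^~ w) m] = 1%E.
  apply/eqP; rewrite eq_le probability_le1//=; last exact: measurable_upper_works.
  rewrite -(distinct_lifetimes T_indep T_cont); apply: le_measure; rewrite ?inE//.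
    exact: measurable_upper_works.
  move=> w /= inj; have [A upA Am] := exists_upper inj mn.
  by rewrite -Am upper_worksE.
rewrite !sumE card_sets => -[]; rewrite -[q *+ _]mulr_natr => q1; congr EFin.
have bin_neq0 : 'C(n, m)%:R != 0 :> R by rewrite pnatr_eq0 -lt0n bin_gt0.
rewrite /upper_works_prob -[q *+ _]mulr_natr.
by rewrite (canRL (mulfK bin_neq0) q1) mul1r mulrC.
Qed.

Variables (phi : {set 'I_n} -> bool) (phi_sc : semicoherent phi).

(** Off ties, [upper_works] at [n - k] is the disjoint union of the event that
the system fails at failure [k.+1] and of [upper_works] at [n - k.+1]. *)
Lemma signatureE k : (k < n)%N -> signature T phi k.+1 =
  upper_works_prob phi (n - k)%N - upper_works_prob phi (n - k.+1)%N.
Proof.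
move=> kn; have [phi_incr _ _] := phi_sc; rewrite /signature.
set E := [set w | _].
have mE : measurable E by exact: measurable_system_lifetime_order_stat.
pose U m := [set w | upper_works phi (T ^~ w) m].
have mU m : measurable (U m) by exact: measurable_upper_works.
have UE : U (n - k)%N `&` distinct =
    (E `&` distinct) `|` (U (n - k.+1)%N `&` distinct).
  apply/seteqP; split => w /=.
    move=> [Uk inj].
    case: (boolP (upper_works phi (T ^~ w) (n - k.+1)%N)) => Uk1.
      by right.
    left; split => //; apply/(system_lifetime_order_stat phi_incr inj kn).
    by rewrite Uk.
  move=> [[]|[]].
    by move=> + inj => /(system_lifetime_order_stat phi_incr inj kn)/andP[].
  move=> Uk inj; split => //; apply: upper_works_leq Uk => //.
  by rewrite leq_subr leq_sub2l.
have disj : E `&` distinct `&` (U (n - k.+1)%N `&` distinct) = set0.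
  apply/seteqP; split => // w [[Ew inj] [/= Uw _]].
  by move/(system_lifetime_order_stat phi_incr inj kn) : Ew; rewrite Uw andbF.
have : P (U (n - k)%N `&` distinct) =
    (P (E `&` distinct) + P (U (n - k.+1)%N `&` distinct))%E.
  by rewrite UE measureU//; exact: measurableI.
rewrite !probability_distinct// !probability_upper_works ?leq_subr//.
have := fin_num_measure P E mE; case: (P E) => [r|//|//] _ [->].
by rewrite addrK.
Qed.

Lemma upper_works_prob0 : upper_works_prob phi 0 = 0.
Proof.
have [_ phi0 _] := phi_sc.
rewrite /upper_works_prob (_ : path_sets phi 0 = finset.set0) ?cards0 ?mul0r//.
apply/finset.setP => A; rewrite !inE cards_eq0.
by case: eqP => [->|]; rewrite ?phi0 ?andbF.
Qed.

Lemma tail_signatureE k : (k <= n)%N ->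
  tail_signature T phi k = upper_works_prob phi (n - k)%N.
Proof.
move=> kn; rewrite /tail_signature big_add1/=.
rewrite (eq_big_nat _ _ (F2 := fun i =>
  - upper_works_prob phi (n - i.+1)%N -
  - upper_works_prob phi (n - i)%N)); last first.
  by move=> i /andP[_ lt_in]; rewrite signatureE// opprK addrC.
by rewrite telescope_sumr// subnn upper_works_prob0 opprK oppr0 add0r.
Qed.

End Signature.

(** * The two identities *)

(** The Beta factor of degree [n], applied to the Bernstein coefficients of [h']
for a system of [n.+1] components, turns them into differences of ratios
[w_i / 'C(n.+1, i)]. *)
Lemma bernstein_deriv_coef (R : realType) (n i : nat) (a b : R) : (i <= n)%N ->
  (i.+1%:R * b - (n.+1 - i)%:R * a) / (n.+1%:R * 'C(n, i)%:R) =
  b / 'C(n.+1, i.+1)%:R - a / 'C(n.+1, i)%:R :> R.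
Proof.
move=> le_in.
have bin_neq0 m l : (l <= m)%N -> 'C(m, l)%:R != 0 :> R.
  by move=> lm; rewrite pnatr_eq0 -lt0n bin_gt0.
have Sn_neq0 m : m.+1%:R != 0 :> R by rewrite pnatr_eq0.
rewrite mulrBl; congr (_ - _).
  rewrite -natrM (mul_bin_diag n.+1 i) natrM -mulrA.
  by rewrite mulrCA invfM mulVKf//; exact: Sn_neq0.
rewrite -natrM (mul_bin_down n.+1 i) natrM subSn//.
by rewrite -mulrA mulrCA invfM mulVKf//; exact: Sn_neq0.
Qed.

Theorem proposition6 (R : realType) (d : measure_display)
  (Omega : measurableType d) (P : probability Omega R)
  (n : nat) (n_ge1 : (1 <= n)%N)
  (phi : {set 'I_n} -> bool) (phi_sc : semicoherent phi)
  (T : 'I_n -> {RV P >-> R})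
  (T_cont : continuously_distributed T)
  (T_indep : mutually_independent T)
  (T_id : identically_distributed T) :
  let h : {poly R} := diag_section R phi in
  (forall x : R,
    \sum_(0 <= k < n.+1) tail_signature T phi k * x ^+ k =
    \int[lebesgue_measure]_(t in `[0, 1])
      (n.+1%:R *
       (reflect_poly n (subst_tx (reflect_poly n h))).[t, x])) /\
  (forall x : R,
    \sum_(1 <= k < n.+1) signature T phi k * x ^+ k =
    \int[lebesgue_measure]_(t in `[0, 1])
      (x *
       (reflect_poly n.-1 (subst_tx (reflect_poly n.-1 h^`()))).[t, x])).
Proof.
move=> h; have h_bern : h = bernstein_form n (fun m => #|path_sets phi m|%:R).
  exact: diag_section_bernstein.
split => x.
  (* The powers of [x] run downwards in the integral: [i] matches [k = n - i]. *)
  rewrite h_bern integral_reflect_subst_bernstein big_mkord.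
  rewrite (reindex_inj rev_ord_inj)/=; apply: eq_bigr => i _.
  rewrite subSS tail_signatureE ?leq_subr// subKn ?leq_ord//.
  by congr (_ * _); rewrite /upper_works_prob invfM mulrACA divff ?mul1r//.
rewrite h_bern; case: n n_ge1 phi phi_sc T T_cont T_indep T_id {h h_bern} => //.
move=> {}n _ {}phi {}phi_sc {}T {}T_cont {}T_indep {}T_id.
rewrite deriv_bernstein_form integral_reflect_subst_bernstein/=.
rewrite big_add1 big_mkord (reindex_inj rev_ord_inj)/=.
apply: eq_bigr => i _; have le_in := leq_ord i.
rewrite subSS signatureE ?ltnS ?leq_subr//.
rewrite subSS subKn// subSn ?leq_subr// subKn//.
by rewrite -(mulrA x) bernstein_deriv_coef// exprS mulrA [_ * x]mulrC.
Qed.
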